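(* Let $(X,G)$ be a dynamical system. (a) If $(X,G)$ is a weakly almost periodic (respectively Bohr almost periodic) dynamical system, then every $x\in X$ is weakly almost periodic (respectively Bohr almost periodic). (b) If $x\in X$ is transitive and weakly almost periodic (respectively Bohr almost periodic), then $(X,G)$ is a weakly almost periodic (respectively Bohr almost periodic) dynamical system.
   Context: $G$ is a locally compact, $\sigma$-compact abelian group, written additively. A dynamical system $(X,G)$ is a compact metrizable space $X$ with a continuous action $G\times X\to X$, $(t,x)\mapsto tx$. A point is transitive if its orbit is dense in $X$. $C(X)$ is the Banach space of continuous complex-valued functions on $X$ with the supremum norm, and $C_u(G)$ is the Banach space of uniformly continuous bounded complex-valued functions on $G$ with the supremum norm. A function $g\in C_u(G)$ is weakly almost periodic if $\{g(\cdot-t):t\in G\}$ is relatively compact in the weak topology of $C_u(G)$. A bounded continuous function $g:G\to\mathbb{C}$ is Bohr almost periodic if for every $\varepsilon>0$ the set $\{t\in G:\|g-g(\cdot-t)\|_\infty<\varepsilon\}$ is relatively dense, i.e. there is a compact $K\subset G$ whose translates by elements of this set cover $G$; equivalently, $\{g(\cdot-t):t\in G\}$ has compact closure with respect to the supremum norm. For $f\in C(X)$ and $x\in X$ put $f_x(t)=f(tx)$, $t\in G$. A point $x\in X$ is weakly (respectively Bohr) almost periodic if $f_x$ is weakly (respectively Bohr) almost periodic for every $f\in C(X)$. The dynamical system $(X,G)$ is weakly almost periodic (respectively Bohr almost periodic) if for every $f\in C(X)$ the family $\{f_t:t\in G\}$, where $f_t(x)=f(tx)$ for $x\in X$, has compact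 closure in the weak topology (respectively the norm topology) of $C(X)$. *)

(* Defs.v *)
From HB Require Import structures.
From mathcomp Require Import all_boot all_order all_algebra.
From mathcomp Require Import all_classical all_reals all_analysis.
From mathcomp Require Import complex.

Set Implicit Arguments.
Unset Strict Implicit.
Unset Printing Implicit Defensive.

Import Order.TTheory GRing.Theory Num.Theory.
Import numFieldNormedType.Exports.

Local Open Scope classical_set_scope.
Local Open Scope ring_scope.

(* [R[i]] carries its topology and normed-module structure through the alias
   [R[i]^o]; the library norm of [R[i]] takes values in [R[i]], whereas
   [cmod] takes values in [R]. *)
Definition cmod (R : rcfType) (z : R[i]) : R := Normc.normc z.

Section Modulus.
Variable R : realType.
Implicit Types z w : R[i].

Lemma normr_cmod z : `|z| = (cmod z)%:C%C.
Proof. by []. Qed.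

Lemma cmod_ge0 z : 0 <= cmod z.
Proof. by rewrite -(@lecR R) -normr_cmod normr_ge0. Qed.

Lemma cmodD z w : cmod (z + w) <= cmod z + cmod w.
Proof. by rewrite -(@lecR R) rmorphD /= -!normr_cmod ler_normD. Qed.

Lemma cmodM z w : cmod (z * w) = cmod z * cmod w.
Proof. exact: Normc.normcM. Qed.

Lemma cmod0 : cmod (0 : R[i]) = 0.
Proof. exact: Normc.normc0. Qed.

Lemma cmod_eq0 z : cmod z = 0 -> z = 0.
Proof. exact: Normc.eq0_normc. Qed.

Lemma cmod_distC z w : cmod (z - w) = cmod (w - z).
Proof.
by have /(congr1 (@complex.Re R)) := distrC z w; rewrite !normr_cmod.
Qed.

Lemma near_cmodP (T : Type) (F : set_system T) (FF : Filter F)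
    (f : T -> R[i]^o) (l : R[i]) :
  f @ F --> (l : R[i]^o) <->
  forall e : R, 0 < e -> \forall x \near F, cmod (l - f x) < e.
Proof.
split => [/cvgrPdist_lt fl e e0|fl].
  have := fl e%:C%C; rewrite ltcR => /(_ e0).
  by apply: filterS => x; rewrite normr_cmod ltcR.
apply/cvgrPdist_lt => -[a b]; rewrite ltcE /= => /andP[/eqP -> a0].
by near=> x; rewrite normr_cmod ltcR; near: x; exact: fl.
Unshelve. all: by end_near. Qed.

End Modulus.

Definition bounded_cfun (R : realType) (T : Type) (f : T -> R[i]) :=
  exists M : R, forall x, cmod (f x) <= M.

Definition supnorm (R : realType) (T : Type) (f : T -> R[i]) : R :=
  sup [set cmod (f x) | x in [set: T]].

Section Supnorm.
Variables (R : realType) (T : Type).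
Implicit Types f g : T -> R[i].

Lemma supnorm_ub f x : bounded_cfun f -> cmod (f x) <= supnorm f.
Proof.
move=> [M fM]; apply: ub_le_sup; last by exists x.
by exists M => _ [y _ <-].
Qed.

Lemma supnorm_ge0 f : 0 <= supnorm f.
Proof.
rewrite /supnorm.
have [fT|/sup_out ->//] := pselect (has_sup [set cmod (f x) | x in setT]).
have [_ [x xT _]] := fT.1.
by apply: le_trans (cmod_ge0 (f x)) _; apply: sup_upper_bound => //; exists x.
Qed.

Lemma supnorm_le f (M : R) :
  0 <= M -> (forall x, cmod (f x) <= M) -> supnorm f <= M.
Proof.
move=> M0 fM; have [[x]|nT] := pselect (inhabited T).
  apply: ge_sup; first by exists (cmod (f x)), x.
  by move=> _ [y _ <-].
suff e0 : [set cmod (f x) | x in [set: T]] = set0 by rewrite /supnorm e0 sup0.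
by rewrite -subset0 => y [x _ _]; exact: nT (inhabits x).
Qed.

End Supnorm.

(* A linear space of bounded complex functions on [T]. *)
Structure bspace (R : realType) (T : Type) := BSpace {
  bs_mem :> {pred T -> R[i]^o};
  bs_submod : submod_closed bs_mem;
  bs_bounded : forall f, f \in bs_mem -> bounded_cfun f }.

Record bsfun (R : realType) (T : Type) (S : bspace R T) := BsFun {
  bs_val :> T -> R[i]^o;
  bs_valP : bs_val \in S }.

(* The supremum norm makes [bsfun S] a normed module over [R[i]]. *)
Section BspaceNormed.
Variables (R : realType) (T : Type) (S : bspace R T).

HB.instance Definition _ := [isSub for @bs_val R T S].
HB.instance Definition _ := [Choice of bsfun S by <:].
HB.instance Definition _ :=
  GRing.isSubmodClosed.Build R[i] (T -> R[i]^o) (bs_mem S) (bs_submod S).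
HB.instance Definition _ := [SubChoice_isSubLmodule of bsfun S by <:].

Implicit Types f g : bsfun S.

Lemma bsfun_bounded f : bounded_cfun f.
Proof. exact: bs_bounded (bs_valP f). Qed.

Let bsnorm f : R[i] := (supnorm f)%:C%C.

Let bsnormD f g : bsnorm (f + g) <= bsnorm f + bsnorm g.
Proof.
rewrite -rmorphD lecR; apply: supnorm_le => [|x].
  by rewrite addr_ge0 ?supnorm_ge0.
apply: le_trans (cmodD _ _) _.
by apply: lerD; apply: supnorm_ub; exact: bsfun_bounded.
Qed.

Let bsnormZ (a : R[i]) f : bsnorm (a *: f) = `|a| * bsnorm f.
Proof.
rewrite normr_cmod -rmorphM; congr (_%:C%C); apply/le_anti/andP; split.
  apply: supnorm_le => [|x]; first by rewrite mulr_ge0 ?supnorm_ge0 ?cmod_ge0.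
  rewrite [X in X <= _](cmodM a (f x)).
  by rewrite ler_wpM2l ?cmod_ge0 ?supnorm_ub//; exact: bsfun_bounded.
have [->|a0] := eqVneq a 0; first by rewrite cmod0 mul0r supnorm_ge0.
have ca0 : 0 < cmod a.
  by rewrite lt_neqAle cmod_ge0 andbT eq_sym; apply: contraNneq a0 => /cmod_eq0->.
rewrite -ler_pdivlMl//; apply: supnorm_le => [|x].
  by rewrite mulr_ge0 ?supnorm_ge0// invr_ge0 cmod_ge0.
rewrite ler_pdivlMl// -(cmodM a (f x)).
exact: (@supnorm_ub _ _ (a *: f) x (@bsfun_bounded _)).
Qed.

Let bsnorm_eq0 f : bsnorm f = 0 -> f = 0.
Proof.
move=> [f0]; apply: val_inj; apply/funext => x; apply: cmod_eq0.
apply/le_anti; rewrite cmod_ge0 andbT -f0.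
by apply: supnorm_ub; exact: bsfun_bounded.
Qed.

HB.instance Definition _ :=
  Lmodule_isNormed.Build R[i] (bsfun S) bsnormD bsnormZ bsnorm_eq0.

Lemma bsfun_normE f : `|f| = (supnorm f)%:C%C.
Proof. by []. Qed.

End BspaceNormed.

Section WeakTopology.
Variables (K : numFieldType) (V : normedModType K).

Definition dual := {l : {linear V -> K^o} | continuous (l : V -> K^o)}.

Definition weak : Type := sup_topology
  (fun l : dual => Topological.class (initial_topology (sval l : V -> K^o))).

HB.instance Definition _ := Topological.on weak.

Lemma weak_cvgP (F : set_system V) (x : V) : Filter F ->
  F --> (x : weak) <->
  forall l : V -> K^o, linear l -> continuous l -> l @ F --> l x.
Proof.
move=> FF; rewrite (cvg_sup _ _ _); split=> [Fx l ll cl|Fx [l cl] /=].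
  pose l' := GRing.isLinear.Build K V K^o _ l ll.
  pose L : {linear V -> K^o} := HB.pack l l'.
  have /(_ (exist _ L cl)) := Fx.
  move=> FL; apply: (cvg_trans _ (@initial_continuous V K^o l x)).
  exact: cvg_app FL.
move=> A [B [[D oD DB] Bx] BA]; apply: filterS BA _; rewrite -DB.
apply: Fx (linearP l) cl _ _; apply: open_nbhs_nbhs; split => //.
by rewrite -DB in Bx.
Qed.

End WeakTopology.

Definition sigma_compact (T : topologicalType) :=
  exists F : nat -> set T,
    (forall n, compact (F n)) /\ \bigcup_n F n = [set: T].

Definition unif_cont (R : realType) (G : topologicalZmodType) (g : G -> R[i]) :=
  forall e : R, 0 < e ->
    \forall u \near (0 : G), forall t, cmod (g (u + t) - g t) < e.

Section UniformlyContinuous.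
Variables (R : realType) (G : topologicalZmodType).

Lemma unif_cont_continuous (g : G -> R[i]^o) : unif_cont g -> continuous g.
Proof.
move=> ug s; apply/near_cmodP => e e0.
have sub_s : (fun r : G => r - s) @ s --> (0 : G).
  rewrite -(subrr s).
  apply: (@continuous2_cvg _ _ _ _ _ _ id (fun=> s) (fun x y : G => x - y)).
  - exact: (@sub_continuous G (s, s)).
  - exact: cvg_id.
  - exact: cvg_cst.
have := sub_s _ (ug e e0); rewrite nbhs_simpl /=.
by apply: filterS => r /(_ s) /=; rewrite subrK cmod_distC.
Qed.

Definition Cu_mem : {pred G -> R[i]^o} :=
  fun g => `[< bounded_cfun g /\ unif_cont g >].

Lemma Cu_submod : submod_closed Cu_mem.
Proof.
split.
  apply/asboolP; split; first by exists 0 => x; rewrite cmod0.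
  by move=> e e0; apply: nearW => u t; rewrite subrr cmod0.
move=> a f g /asboolP[[M fM] uf] /asboolP[[N gN] ug]; apply/asboolP; split.
  exists (cmod a * M + N) => x; apply: le_trans (cmodD _ _) _.
  by apply: lerD => //; rewrite [X in X <= _]cmodM ler_wpM2l ?cmod_ge0.
move=> e e0.
have a1 : 0 < cmod a + 1 by rewrite ltr_wpDl ?cmod_ge0.
have /uf : 0 < e / 2 / (cmod a + 1) by rewrite !divr_gt0.
have /ug : 0 < e / 2 by rewrite divr_gt0.
apply: filterS2 => u gu fu t.
have -> : (a *: f + g) (u + t) - (a *: f + g) t =
    a * (f (u + t) - f t) + (g (u + t) - g t).
  by rewrite mulrBr opprD addrACA.
rewrite (splitr e); apply: le_lt_trans (cmodD _ _) _.
apply: ler_ltD; last exact: gu.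
rewrite cmodM; have /ltW := fu t; rewrite ler_pdivlMr// mulrC => fut.
by apply: le_trans fut; rewrite ler_wpM2r ?cmod_ge0// lerDl.
Qed.

Lemma Cu_bounded (g : G -> R[i]^o) : g \in Cu_mem -> bounded_cfun g.
Proof. by case/asboolP. Qed.

Definition Cu_space := BSpace Cu_submod Cu_bounded.

Definition Cu := bsfun Cu_space.

Lemma translate_subproof (g : Cu) (t : G) :
  (fun s => g (s - t)) \in Cu_space.
Proof.
have /asboolP[[M gM] ug] := bs_valP g; apply/asboolP; split.
  by exists M => s; exact: gM.
move=> e e0; apply: filterS (ug e e0) => u gu s.
by rewrite -addrA; exact: gu.
Qed.

Definition translate (g : Cu) (t : G) : Cu :=
  @BsFun _ _ Cu_space _ (translate_subproof g t).

Definition weakly_almost_periodic (g : Cu) :=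
  precompact ([set translate g t | t in [set: G]] : set (weak Cu)).

Definition relatively_dense (A : set G) :=
  exists K : set G, compact K /\
    forall s, exists t k, [/\ A t, K k & s = t + k].

Definition bohr_almost_periodic (g : G -> R[i]^o) :=
  [/\ continuous g, bounded_cfun g &
    forall e : R, 0 < e ->
      relatively_dense [set t | supnorm (fun s => g s - g (s - t)) < e]].

End UniformlyContinuous.

(* The metric only serves to fix a metrizable topology: no definition below
   refers to the distance. *)
Record dynamical_system (R : realType) (G : topologicalZmodType) := DynSys {
  ds_space :> metricType R;
  ds_compact : compact [set: ds_space];
  act : G -> ds_space -> ds_space;
  act0 : forall x, act 0 x = x;
  actD : forall s t x, act (s + t) x = act s (act t x);
  act_continuous : continuous (fun p : G * ds_space => act p.1 p.2) }.

Section DynamicalSystem.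
Variables (R : realType) (G : topologicalZmodType) (X : dynamical_system R G).

Definition C_mem : {pred X -> R[i]^o} := fun f => `[< continuous f >].

Lemma C_submod : submod_closed C_mem.
Proof.
split; first by apply/asboolP => x; exact: cvg_cst.
move=> a f g /asboolP cf /asboolP cg; apply/asboolP => x.
by apply: cvgD; [apply: cvgZ; [exact: cvg_cst|exact: cf]|exact: cg].
Qed.

Lemma C_bounded (f : X -> R[i]^o) : f \in C_mem -> bounded_cfun f.
Proof.
move=> /asboolP cf.
have : \forall M \near +oo%R, [set: X] `<=` [set x | cmod (f x) <= M :> R].
  move/compact_near_coveringP: (@ds_compact _ _ X); apply => x _.
  have /near_cmodP/(_ 1 ltr01) fx := cf x.
  exists ([set y | cmod (f x - f y) < 1], [set M | 1 + cmod (f x) <= M]).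
    by split; [exact: fx|exact: nbhs_pinfty_ge (num_real _)].
  move=> [y M] [/= fxy fM]; apply: le_trans fM.
  rewrite -[f y](subrK (f x)); apply: le_trans (cmodD _ _) _.
  by rewrite lerD2r cmod_distC ltW.
by move=> /filter_ex[M fM]; exists M => x; exact: fM.
Qed.

Definition C_space := BSpace C_submod C_bounded.

Definition C := bsfun C_space.

Lemma f_t_subproof (f : C) (t : G) : (fun x => f (act t x)) \in C_space.
Proof.
have /asboolP cf := bs_valP f; apply/asboolP => x.
apply: (@continuous_comp _ _ _ (@act _ _ X t) f); last exact: cf.
apply: (@continuous_comp _ _ _ (fun y => (t, y)) (fun p => act p.1 p.2)).
  by apply: cvg_pair; [exact: cvg_cst|exact: cvg_id].
exact: act_continuous.
Qed.

Definition f_t (f : C) (t : G) : C := @BsFun _ _ C_space _ (f_t_subproof f t).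

Lemma f_x_subproof (f : C) (x : X) : (fun t => f (act t x)) \in Cu_space R G.
Proof.
have /asboolP cf := bs_valP f; apply/asboolP; split.
  by have [M fM] := bsfun_bounded f; exists M => t; exact: fM.
move=> e e0.
suff : \forall u \near (0 : G),
    [set: X] `<=` [set z | cmod (f (act u z) - f z) < e].
  by apply: filterS => u fu t; rewrite actD; exact: fu.
move/compact_near_coveringP: (@ds_compact _ _ X); apply => y _.
have e20 : 0 < e / 2 by rewrite divr_gt0.
have := @continuous_comp _ _ _ (fun p : G * X => act p.1 p.2)
  (bs_val f) ((0 : G), y) (@act_continuous _ _ X _) (cf _).
move=> /near_cmodP/(_ _ e20); rewrite /= act0 => f_near.
have /near_cmodP/(_ _ e20) fy := cf y.
have [[U V] /= [U0 Vy] UV] := f_near.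
exists (V `&` [set z | cmod (f y - f z) < e / 2], U).
  by split => //; exact: filterI.
move=> [z u] /= [[Vz fyz] Uu].
rewrite -(subrKA (f y)) (splitr e); apply: le_lt_trans (cmodD _ _) _.
by apply: ltrD => //; rewrite cmod_distC; exact: (UV (u, z)).
Qed.

Definition f_x (f : C) (x : X) : Cu R G := @BsFun _ _ (Cu_space R G) _ (f_x_subproof f x).

Definition transitive_point (x : X) := dense [set act t x | t in [set: G]].

Definition weakly_ap_point (x : X) :=
  forall f : C, weakly_almost_periodic (f_x f x).

Definition bohr_ap_point (x : X) :=
  forall f : C, bohr_almost_periodic (f_x f x).

Definition weakly_ap_system :=
  forall f : C, precompact ([set f_t f t | t in [set: G]] : set (weak C)).

Definition bohr_ap_system :=
  forall f : C, precompact [set f_t f t | t in [set: G]].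

End DynamicalSystem.

(* Main.v *)
(* For x in X the orbit map T f = f_x is linear and norm-nonincreasing from
   C(X) to C_u(G), hence weakly continuous, and T f_t is the translate of f_x by
   -t; so T sends relatively compact orbits to relatively compact orbits, which
   is (a).
   If x is transitive then T is isometric, with closed range since C(X) is
   complete. By Hahn-Banach the range is weakly closed and every functional on
   C(X) extends along T, so T is a homeomorphism onto a closed set for the weak
   topologies and preimages of weakly compact sets are weakly compact.
   In the Bohr case everything is read off the distances |f_s - f_t|: norm
   relative compactness of {f_t} is total boundedness. Finitely many centers t_i
   give the compact set {t_i} witnessing relative density; conversely, if every
   t is an almost period plus an element of a compact K, uniform continuity of
   f_x covers K by finitely many centers. *)
Require Import Defs.
From HB Require Import structures.
From mathcomp Require Import all_boot all_order all_algebra.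
From mathcomp Require Import all_classical all_reals all_analysis complex.
From mathcomp Require Import ring lra.

Set Implicit Arguments.
Unset Strict Implicit.
Unset Printing Implicit Defensive.

Import Order.TTheory GRing.Theory Num.Theory.
Import numFieldNormedType.Exports.

Local Open Scope classical_set_scope.
Local Open Scope ring_scope.

(** * The Hahn-Banach theorem *)

Definition sublinear (R : realType) (V : lmodType R) (p : V -> R) :=
  (forall x y, p (x + y) <= p x + p y) /\
  (forall t x, 0 <= t -> p (t *: x) <= t * p x).

Section Sublinear.
Variables (R : realType) (V : lmodType R) (p : V -> R).
Hypothesis p_sub : sublinear p.

(** For [t > 0] the reverse inequality is the assumed one for [t^-1] at [t *: x]; at [t = 0]
    subadditivity gives [0 <= p 0]. *)
Lemma sublinearZ t x : 0 <= t -> p (t *: x) = t * p x.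
Proof.
move=> t0; apply/le_anti/andP; split; first exact: p_sub.2.
have [<-|tN0] := eqVneq 0 t; last first.
  rewrite -ler_pdivlMl ?lt0r ?t0 1?eq_sym ?tN0//.
  have := p_sub.2 t^-1 (t *: x); rewrite invr_ge0 => /(_ t0).
  by rewrite scalerA mulVf ?scale1r// eq_sym.
have := p_sub.1 0 0; rewrite addr0 mul0r scale0r => p00.
by rewrite -subr_ge0 -(lerD2r (p 0)) in p00 *; lra.
Qed.

Lemma sublinear0 : p 0 = 0.
Proof. by rewrite -(scale0r (0 : V)) sublinearZ// mul0r. Qed.

Lemma sublinearN x : - p (- x) <= p x.
Proof. by have := p_sub.1 x (- x); rewrite subrr sublinear0 => ?; lra. Qed.

(* If [p] is a minimal sublinear functional then [tilt y] must equal [p], and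
   the term [t = 1] of the infimum then says that [p] is additive. *)
Definition tilt (y x : V) : R :=
  inf [set p (x + t *: y) - t * p y | t in [set t | 0 <= t]].

Let tilt_lb y x :
  lbound [set p (x + t *: y) - t * p y | t in [set t | 0 <= t]] (- p (- x)).
Proof.
move=> _ [t /= t0 <-]; have := p_sub.1 (x + t *: y) (- x).
by rewrite addrAC subrr add0r sublinearZ// => ?; lra.
Qed.

Lemma tilt_le y x t : 0 <= t -> tilt y x <= p (x + t *: y) - t * p y.
Proof.
by move=> t0; apply: ge_inf; [exists (- p (- x)); exact: tilt_lb|exists t].
Qed.

Lemma le_tilt y x m :
  (forall t, 0 <= t -> m <= p (x + t *: y) - t * p y) -> m <= tilt y x.
Proof.
move=> mle; apply: lb_le_inf.
  by exists (p (x + 0 *: y) - 0 * p y), 0 => /=.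
by move=> _ [t /= t0 <-]; exact: mle.
Qed.

Lemma tilt_le_sublinear y x : tilt y x <= p x.
Proof.
by apply: le_trans (tilt_le y x (lexx _)) _; rewrite scale0r addr0 mul0r subr0.
Qed.

(** Competitors [t1] for [x1] and [t2] for [x2] give the competitor [t1 + t2] for [x1 + x2]; a
    competitor [t] for [x] gives [s * t] for [s *: x]. *)
Lemma tilt_sublinear y : sublinear (tilt y).
Proof.
split=> [x1 x2|s x].
  rewrite -lerBlDr; apply: le_tilt => t1 t10.
  rewrite lerBlDr -lerBlDl; apply: le_tilt => t2 t20.
  rewrite lerBlDl; apply: le_trans (tilt_le y _ (addr_ge0 t10 t20)) _.
  have := p_sub.1 (x1 + t1 *: y) (x2 + t2 *: y).
  by rewrite addrACA -scalerDl => ?; rewrite mulrDl; lra.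
rewrite le_eqVlt => /predU1P[<-|s0].
  by rewrite scale0r mul0r -sublinear0; exact: tilt_le_sublinear.
rewrite -ler_pdivrMl//; apply: le_tilt => t t0; rewrite ler_pdivrMl//.
apply: le_trans (tilt_le y _ (mulr_ge0 (ltW s0) t0)) _.
by rewrite -scalerA -scalerDr (sublinearZ _ (ltW s0)) mulrBr mulrA.
Qed.

End Sublinear.

(** Directedness replaces two members by one below both, whence subadditivity; the lower bound [b]
    makes each infimum a genuine one. This supplies the bounds of chains in Zorn's lemma. *)
Lemma inf_sublinear (R : realType) (V : lmodType R) (A : set (V -> R))
    (b : V -> R) :
  A !=set0 -> (forall q, A q -> sublinear q) ->
  (forall q x, A q -> b x <= q x) ->
  (forall q1 q2, A q1 -> A q2 ->
    exists q, [/\ A q, forall x, q x <= q1 x & forall x, q x <= q2 x]) ->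
  sublinear (fun x => inf [set q x | q in A]).
Proof.
move=> [q0 Aq0] As Ab Ad.
have infA_le q x : A q -> inf [set q x | q in A] <= q x.
  move=> Aq; apply: ge_inf; last by exists q.
  by exists (b x) => _ [r Ar <-]; exact: Ab.
have le_infA x m : (forall q, A q -> m <= q x) -> m <= inf [set q x | q in A].
  move=> mA; apply: lb_le_inf; first by exists (q0 x), q0.
  by move=> _ [q Aq <-]; exact: mA.
split=> [x y|s x].
  rewrite -lerBlDr; apply: (le_infA) => q1 Aq1.
  rewrite lerBlDr -lerBlDl; apply: (le_infA) => q2 Aq2.
  have [q [Aq qq1 qq2]] := Ad _ _ Aq1 Aq2.
  rewrite lerBlDl; apply: le_trans (infA_le q _ Aq) _.
  by apply: le_trans ((As _ Aq).1 x y) _; exact: lerD.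
rewrite le_eqVlt => /predU1P[<-|s0].
  rewrite scale0r mul0r; apply: le_trans (infA_le q0 _ Aq0) _.
  by rewrite sublinear0//; exact: As.
rewrite -ler_pdivrMl//; apply: le_infA => q Aq; rewrite ler_pdivrMl//.
by apply: le_trans (infA_le q _ Aq) _; apply: (As _ Aq).2; exact: ltW.
Qed.

Lemma minimal_sublinear (R : realType) (V : lmodType R) (p : V -> R) :
  sublinear p ->
  exists q : V -> R, [/\ sublinear q, forall x, q x <= p x &
    forall r : V -> R, sublinear r -> (forall x, r x <= q x) -> r = q].
Proof.
move=> ps; pose T := {q : V -> R | sublinear q /\ forall x, q x <= p x}.
(* The order is reversed: a maximal element for [le] is a minimal functional. *)
pose le (q r : T) := `[< forall x, sval r x <= sval q x >].
have [|q r s /asboolP rq /asboolP sr|q r /asboolP rq /asboolP qr|A tA|] :=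
    @Zorn T le.
- by move=> q; exact/asboolP.
- by apply/asboolP => x; exact: le_trans (sr x) (rq x).
- case: q r rq qr => [q qP] [r rP] /= rq qr; apply: eq_exist.
  by apply/funext => x; apply/le_anti; rewrite rq qr.
(* The empty chain is bounded by [p], any other by its pointwise infimum, which is finite because
   every member lies above [- p (- x)]. *)
- have [[q0 Aq0]|A0] := pselect (A !=set0); last first.
    have pp : sublinear p /\ forall x, p x <= p x by [].
    by exists (exist _ p pp) => q Aq; case: A0; exists q.
  pose B := sval @` A.
  pose r x := inf [set q x | q in B].
  have Bs q : B q -> sublinear q by move=> [[{}q [qs qp]] _ <-].
  have Bb q x : B q -> - p (- x) <= q x.
    move=> [[{}q [qs qp]] /= _ <-]; apply: le_trans (sublinearN qs x).
    by rewrite lerN2.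
  have rB q x : B q -> r x <= q x.
    move=> Bq; apply: ge_inf; last by exists q.
    by exists (- p (- x)) => _ [s Bs' <-]; exact: Bb.
  have rs : sublinear r.
    apply: (@inf_sublinear _ _ B (fun x => - p (- x))) => //.
      by exists (sval q0), q0.
    move=> _ _ [q1 Aq1 <-] [q2 Aq2 <-].
    have [/asboolP q12|/asboolP q21] := tA _ _ Aq1 Aq2.
      by exists (sval q2); split=> //; exists q2.
    by exists (sval q1); split=> //; exists q1.
  have rp x : r x <= p x.
    apply: le_trans (rB (sval q0) x _) _; first by exists q0.
    by case: q0 {Aq0} => q [].
  exists (exist _ r (conj rs rp)) => q Aq; apply/asboolP => x.
  by apply: rB; exists q.
move=> [q [qs qp]] qmin; exists q; split=> // r rs rq.
have rp x : r x <= p x := le_trans (rq x) (qp x).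
have /(_ _)/(congr1 sval) := qmin (exist _ r (conj rs rp)).
by apply; exact/asboolP.
Qed.

Theorem hahn_banach (R : realType) (V : lmodType R) (p : V -> R) (g : V) :
  sublinear p ->
  exists u : V -> R, [/\ scalar u, forall x, u x <= p x & u g = p g].
Proof.
(* Minimizing below [tilt p g] rather than below [p] is what forces the value at [g]. *)
move=> ps; have [u [us up umin]] := minimal_sublinear (tilt_sublinear ps g).
have u_tilt y : tilt u y = u.
  by apply: umin; [exact: tilt_sublinear|exact: tilt_le_sublinear].
have uD x y : u (x + y) = u x + u y.
  apply/le_anti; rewrite us.1 -lerBrDr /=.
  have := tilt_le us y x (@ler01 R); rewrite u_tilt scale1r mul1r.
  by [].
have uN x : u (- x) = - u x.
  by apply/eqP; rewrite -addr_eq0 -uD addNr sublinear0.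
exists u; split=> [a x y|x|].
- rewrite uD; congr (_ + _); have [a0|/ltW a0] := leP 0 a.
    by rewrite sublinearZ.
  have : u ((- a) *: x) = (- a) * u x by rewrite sublinearZ// oppr_ge0.
  by rewrite scaleNr uN mulNr => /oppr_inj.
- exact: le_trans (up x) (tilt_le_sublinear ps g x).
- apply/le_anti; rewrite (le_trans (up g) (tilt_le_sublinear ps g g))/=.
  (* The term [t = 1] of the infimum at [- g] gives [u (- g) <= p 0 - p g = - p g]. *)
  rewrite -lerN2 -uN; apply: le_trans (up _) _.
  apply: le_trans (tilt_le ps g (- g) (@ler01 R)) _.
  by rewrite scale1r addNr sublinear0// mul1r sub0r.
Qed.

(** The infimum in the last clause, as a function of [g], is sublinear, lies below [N] (take
    [w = 0]) and is at most [f w] at [T w]. A linear [u] below it satisfies [u (T w) <= f w] for [w]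
    and [- w], hence equality. For [f = 0] the value at [g] is the [N]-distance from [g] to the
    range of [T]. *)
Theorem hahn_banach_extension (R : realType) (W V : lmodType R) (N : V -> R)
    (T : W -> V) (f : W -> R) (g : V) :
  sublinear N -> linear T -> scalar f -> (forall w, f w <= N (T w)) ->
  exists u : V -> R, [/\ scalar u, forall v, u v <= N v,
    forall w, u (T w) = f w &
    u g = inf [set N (g - T w) + f w | w in [set: W]]].
Proof.
move=> Ns Tl fl fN.
have [TB fB] := (zmod_morphism_linear Tl, zmod_morphism_linear fl).
have [T0 f0] : T 0 = 0 /\ f 0 = 0.
  by rewrite -(subrr (0 : W)) TB fB !subrr.
have [TN fN'] : (forall w, T (- w) = - T w) /\ forall w, f (- w) = - f w.
  by split=> w; rewrite -[- w]add0r (TB, fB) (T0, f0) add0r.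
have TD w1 w2 : T (w1 + w2) = T w1 + T w2.
  by rewrite -{1}(scale1r w1) Tl scale1r.
have fD w1 w2 : f (w1 + w2) = f w1 + f w2 by rewrite -{1}(scale1r w1) fl mul1r.
have TZ a w : T (a *: w) = a *: T w by rewrite -[a *: w]addr0 Tl T0 addr0.
have fZ a w : f (a *: w) = a * f w by rewrite -[a *: w]addr0 fl f0 addr0.
pose p v := inf [set N (v - T w) + f w | w in [set: W]].
have p_lb v w : - N (- v) <= N (v - T w) + f w.
  have := Ns.1 (v - T w) (- v); rewrite addrAC subrr add0r -TN.
  by have := fN (- w); rewrite fN' => ? ?; lra.
have p_le v w : p v <= N (v - T w) + f w.
  by apply: ge_inf; [exists (- N (- v)) => _ [w' _ <-]; exact: p_lb|exists w].
have le_p v m : (forall w, m <= N (v - T w) + f w) -> m <= p v.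
  move=> mle; apply: lb_le_inf; first by exists (N (v - T 0) + f 0), 0.
  by move=> _ [w _ <-].
have ps : sublinear p.
  split=> [v1 v2|s v].
    rewrite -lerBlDr; apply: (le_p) => w1.
    rewrite lerBlDr -lerBlDl; apply: (le_p) => w2.
    rewrite lerBlDl; apply: le_trans (p_le _ (w1 + w2)) _.
    have := Ns.1 (v1 - T w1) (v2 - T w2).
    by rewrite addrACA -opprD -TD fD => ?; lra.
  rewrite le_eqVlt => /predU1P[<-|s0].
    rewrite scale0r mul0r; apply: le_trans (p_le _ 0) _.
    by rewrite T0 f0 subr0 (sublinear0 Ns) addr0.
  rewrite -ler_pdivrMl//; apply: (le_p) => w; rewrite ler_pdivrMl//.
  apply: le_trans (p_le _ (s *: w)) _.
  rewrite TZ fZ -scalerBr.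
  by rewrite (sublinearZ Ns _ (ltW s0)) mulrDr.
have [u [ul up ug]] := hahn_banach g ps.
have uT w : u (T w) <= f w.
  apply: le_trans (up _) _; have := p_le (T w) w.
  by rewrite subrr (sublinear0 Ns) add0r.
exists u; split=> // [v|w].
  by apply: le_trans (up v) _; have := p_le v 0; rewrite T0 f0 subr0 addr0.
apply/le_anti; rewrite uT -lerN2 -fN'; apply: le_trans _ (uT (- w)).
by rewrite TN -[- T w]add0r (zmod_morphism_linear ul) -(subrr 0)
  (zmod_morphism_linear ul) subrr sub0r.
Qed.

(** * Complex functionals and weak topologies *)

Section ComplexModulus.
Variable R : realType.
Implicit Types z : R[i].

Lemma cmod_real (t : R) : cmod t%:C%C = `|t|.
Proof. by rewrite /cmod /= expr0n addr0 sqrtr_sqr. Qed.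

Lemma cmod_i : cmod ('i%C : R[i]) = 1.
Proof. by rewrite /cmod /= expr0n add0r expr1n sqrtr1. Qed.

Lemma ler_Re_cmod z : `|complex.Re z| <= cmod z.
Proof.
case: z => a b; rewrite /cmod /= -sqrtr_sqr ler_wsqrtr//.
by rewrite lerDl sqr_ge0.
Qed.

Lemma ler_Im_cmod z : `|complex.Im z| <= cmod z.
Proof.
case: z => a b; rewrite /cmod /= -sqrtr_sqr ler_wsqrtr//.
by rewrite lerDr sqr_ge0.
Qed.

Lemma cmod_le_ReIm z : cmod z <= `|complex.Re z| + `|complex.Im z|.
Proof.
rewrite [z in X in X <= _]complexE; apply: le_trans (cmodD _ _) _.
rewrite cmodM !cmod_real lerD2l.
by rewrite cmod_i mul1r.
Qed.

Lemma complex_cauchy_cvg (T : Type) (F : set_system T) (f : T -> R[i]^o) :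
  ProperFilter F ->
  (forall e : R, 0 < e -> exists z, \forall x \near F, cmod (z - f x) < e) ->
  exists l : R[i]^o, f @ F --> l.
Proof.
move=> FF fc.
have cvg_part (p : R[i] -> R) : (forall z w, p (z - w) = p z - p w) ->
    (forall z, `|p z| <= cmod z) -> exists l : R, (p \o f) @ F --> l.
  move=> pB pc; suff /cvg_ex[l pfl] : cvg ((p \o f) @ F) by exists l.
  apply: cauchy_cvg; apply: cauchy_exP => e e0.
  have [z fz] := fc e e0; exists (p z); apply: filterS fz => x zx.
  by rewrite /ball /= -pB; apply: le_lt_trans (pc _) zx.
have [a fa] : exists a : R, (@complex.Re R \o f) @ F --> a.
  by apply: cvg_part => [[? ?] [? ?]|]//; exact: ler_Re_cmod.
have [b fb] : exists b : R, (@complex.Im R \o f) @ F --> b.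
  by apply: cvg_part => [[? ?] [? ?]|]//; exact: ler_Im_cmod.
exists (a +i* b)%C; apply/near_cmodP => e e0.
have e20 : 0 < e / 2 by rewrite divr_gt0.
have /cvgrPdist_lt/(_ _ e20) := fa; have /cvgrPdist_lt/(_ _ e20) := fb.
apply: filterS2 => x /= fbx fax; apply: le_lt_trans (cmod_le_ReIm _) _.
by rewrite (splitr e); case: (f x) fax fbx => c d /= ? ?; rewrite ltrD.
Qed.

End ComplexModulus.

(** A separate name for [V] keeps the real scalar action apart from the complex one; the real
    Hahn-Banach theorem is applied to it. *)
Definition realified (R : realType) (V : lmodType R[i]) : Type := V.

Section Realified.
Variables (R : realType) (V : lmodType R[i]).

HB.instance Definition _ := GRing.Zmodule.on (realified V).

Let scale (a : R) (v : realified V) : realified V := a%:C%C *: (v : V).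

Let scaleA a b v : scale a (scale b v) = scale (a * b) v.
Proof. by rewrite /scale scalerA rmorphM. Qed.

Let scale1 : left_id 1 scale.
Proof. exact: scale1r. Qed.

Let scaleDr : right_distributive scale +%R.
Proof. by move=> a v w; exact: scalerDr. Qed.

Let scaleDl v : {morph scale^~ v : a b / a + b}.
Proof. by move=> a b; rewrite /scale rmorphD/= scalerDl. Qed.

HB.instance Definition _ := GRing.Zmodule_isLmodule.Build R (realified V)
  scaleA scale1 scaleDr scaleDl.

Lemma realifiedZ (a : R) (v : realified V) : a *: v = a%:C%C *: (v : V).
Proof. by []. Qed.

End Realified.

Section RealNorm.
Variables (R : realType) (V : normedModType R[i]).
Implicit Types v w : V.

(** The norm of [V] is [R[i]]-valued but real, so its real part loses nothing. *)
Definition rnorm v : R := complex.Re `|v|.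

Lemma normr_rnorm v : `|v| = (rnorm v)%:C%C.
Proof.
rewrite /rnorm; have := normr_ge0 v; case: `|v| => a b.
by rewrite lecE /= => /andP[/eqP ->].
Qed.

Lemma rnorm_ge0 v : 0 <= rnorm v.
Proof. by rewrite -(@lecR R) -normr_rnorm normr_ge0. Qed.

Lemma rnormD v w : rnorm (v + w) <= rnorm v + rnorm w.
Proof. by rewrite -(@lecR R) rmorphD /= -!normr_rnorm ler_normD. Qed.

Lemma rnormZ a v : rnorm (a *: v) = cmod a * rnorm v.
Proof. by rewrite {1}/rnorm normrZ normr_cmod normr_rnorm -rmorphM. Qed.

Lemma rnorm_eq0 v : rnorm v = 0 -> v = 0.
Proof. by move=> v0; apply/normr0_eq0; rewrite normr_rnorm v0. Qed.

Lemma rnorm_distC v w : rnorm (v - w) = rnorm (w - v).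
Proof. by rewrite /rnorm distrC. Qed.

Lemma nbhs_rnormP v (B : set V) : nbhs v B <->
  exists2 e : R, 0 < e & forall w, rnorm (v - w) < e -> B w.
Proof.
split=> [/nbhs_ballP[[a b] /=]|[e e0 eB]].
  rewrite ltcE /= => /andP[/eqP -> a0] aB; exists a => // w vw.
  by apply: aB; rewrite -ball_normE /= normr_rnorm ltcR.
apply/nbhs_ballP; exists e%:C%C; first by rewrite /= ltcR.
by move=> w; rewrite -ball_normE /= normr_rnorm ltcR; exact: eB.
Qed.

Lemma rnorm_sublinear c : 0 <= c ->
  sublinear (fun v : realified V => c * rnorm v).
Proof.
move=> c0; split=> [v w|t v t0]; first by rewrite -mulrDr ler_wpM2l ?rnormD.
by rewrite realifiedZ rnormZ mulrCA cmod_real ger0_norm.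
Qed.

(** The classical complexification [l v = u v - i u (i v)]: it is complex linear, and bounded
    because [u] is. *)
Lemma complex_functional (u : realified V -> R) c :
  0 <= c -> scalar u -> (forall v, u v <= c * rnorm v) ->
  exists l : V -> R[i]^o,
    [/\ linear l, continuous l & forall v, complex.Re (l v) = u v].
Proof.
move=> c0 ul uc; pose l v : R[i]^o := (u v +i* (- u ('i%C *: v)))%C.
have u0 : u 0 = 0 by rewrite -(subrr (0 : V)) (zmod_morphism_linear ul) subrr.
have uN v : u (- v) = - u v.
  by rewrite -[- v]add0r (zmod_morphism_linear ul) u0 sub0r.
have uD v w : u (v + w) = u v + u w.
  by have := ul 1 v w; rewrite scale1r mul1r.
have uZ (a : R) v : u (a%:C%C *: v) = a * u v.
  by have := ul a v 0; rewrite realifiedZ !addr0 u0 addr0.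
have uZi (a : R) v : u (('i * a%:C)%C *: v) = a * u ('i%C *: v).
  by rewrite mulrC -scalerA uZ.
have ll : linear l.
  move=> [a b] v w; rewrite /l.
  have -> : (a +i* b)%C = a%:C%C + 'i%C * b%:C%C by rewrite [LHS]complexE.
  rewrite scalerDr scalerA mulrDr mulrA -expr2 sqr_i mulN1r !scalerDl scaleNr.
  rewrite !(uD, uN, uZ, uZi); apply/eqP; rewrite eq_complex; apply/andP; split.
    by apply/eqP => /=; ring.
  by apply/eqP => /=; ring.
pose L : {linear V -> R[i]^o} := HB.pack l (GRing.isLinear.Build _ _ _ _ l ll).
exists l; split=> //; apply: (@bounded_linear_continuous _ _ _ L).
apply/linear_boundedP; near=> r => v.
(* One [c] for the real part and one for the imaginary part; this crude bound suffices for
   continuity. *)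
apply: (@le_trans _ _ ((c + c)%:C%C * `|v|)); last first.
  rewrite ler_wpM2r//; near: r; apply: nbhs_pinfty_ge.
  by rewrite realE lecR addr_ge0.
have absu w : `|u w| <= c * rnorm w.
  rewrite ler_norml uc andbT lerNl -uN; apply: le_trans (uc _) _.
  by rewrite /rnorm normrN.
rewrite (normr_rnorm v) -rmorphM (normr_cmod (l v)) lecR.
have -> : l v = (u v)%:C%C + 'i%C * (- u ('i%C *: v))%:C%C.
  by rewrite [LHS]complexE.
apply: le_trans (cmodD _ _) _; rewrite cmodM.
rewrite cmod_i mul1r !cmod_real normrN mulrDl lerD//.
by apply: le_trans (absu _) _; rewrite rnormZ cmod_i mul1r.
Unshelve. all: by end_near. Qed.

End RealNorm.

Lemma Re_linear (R : realType) (W : lmodType R[i]) (l : W -> R[i]^o) :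
  linear l -> scalar (fun w : realified W => complex.Re (l w)).
Proof.
move=> ll a v w; rewrite realifiedZ ll.
by case: (l v) (l w) => [x y] [x' y'] /=; rewrite mul0r subr0.
Qed.

Lemma continuous_functional_bound (R : realType) (W : normedModType R[i])
    (l : W -> R[i]^o) : linear l -> continuous l ->
  exists2 c : R, 0 <= c & forall w, cmod (l w) <= c * rnorm w.
Proof.
move=> ll cl.
pose L : {linear W -> R[i]^o} := HB.pack l (GRing.isLinear.Build _ _ _ _ l ll).
have /linear_bounded_continuous/linear_boundedP lb : continuous L by exact: cl.
have [r [r0 rl]] : exists r : R[i], 0 <= r /\ forall w, `|l w| <= r * `|w|.
  near (pinfty_nbhs R[i]) => r; exists r; split.
    by near: r; exact: nbhs_pinfty_ge.
  by near: r; exact: lb.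
exists (complex.Re r) => [|w].
  by move: r0; rewrite lecE /= => /andP[].
have := rl w; rewrite normr_rnorm normr_cmod.
case: r {r0 rl} => a b; rewrite lecE /= => /andP[_].
by rewrite mulr0 subr0.
Unshelve. all: by end_near. Qed.

(** The imaginary part of [l w] is minus the real part of [l] at ['i *: w]. *)
Lemma Re_linear_inj (R : realType) (W : lmodType R[i]) (l m : W -> R[i]^o) :
  linear l -> linear m -> (forall w, complex.Re (l w) = complex.Re (m w)) ->
  l = m.
Proof.
move=> ll lm lmE; apply/funext => w.
have Zi (k : W -> R[i]^o) : linear k -> k ('i%C *: w) = 'i%C * k w.
  move=> lk; have k0 : k 0 = 0.
    by rewrite -(subrr (0 : W)) (zmod_morphism_linear lk) subrr.
  by have := lk 'i%C w 0; rewrite k0 !addr0.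
have := lmE ('i%C *: w); have := lmE w; rewrite !Zi//.
case: (l w) (m w) => [x y] [x' y'] /= ->; rewrite !mul0r !mul1r !sub0r.
by move=> /oppr_inj ->.
Qed.

Lemma ultra_fmap (S U : Type) (f : S -> U) (F : set_system S) :
  UltraFilter F -> UltraFilter (f @ F).
Proof.
move=> UF; split=> [|G GF FG]; first exact: fmap_proper_filter.
rewrite eqEsubset; split=> // A GA.
have [//|FnA] := in_ultra_setVsetC (f @^-1` A) UF.
have GnA : G (~` A) by exact: FG.
by have [x []] := filter_ex (filterI GA GnA).
Qed.

(** * Isometric embeddings and weak topologies *)

Section WeakEmbedding.
Variables (R : realType) (W V : normedModType R[i]) (T : W -> V).
Hypotheses (Tl : linear T) (T_isom : forall w, `|T w| = `|w|).

Let rT (w : realified W) : realified V := T w.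
Let rTl : linear rT.
Proof. by move=> a v w; exact: Tl. Qed.

(** Since [T] is isometric, a bound of [l] by [c * rnorm w] is one by [c * rnorm (T w)]. The real
    part then extends along [T], and complexifying the extension recovers [l] on the range. *)
Lemma functional_extension (l : W -> R[i]^o) : linear l -> continuous l ->
  exists L : V -> R[i]^o,
    [/\ linear L, continuous L & forall w, L (T w) = l w].
Proof.
move=> ll cl; have [c c0 lc] := continuous_functional_bound ll cl.
have [] := @hahn_banach_extension R (realified W) (realified V) _ rT _ 0
  (rnorm_sublinear V c0) rTl (Re_linear ll).
  move=> w; have -> : rnorm (rT w : V) = rnorm (w : W) by rewrite /rnorm T_isom.
  apply: le_trans (lc w); exact: le_trans (ler_norm _) (ler_Re_cmod _).
move=> u [ul uc uT _]; have [L [Ll cL LRe]] := complex_functional c0 ul uc.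
exists L; split=> // w.
have LTl : linear (L \o T) by move=> a v v' /=; rewrite Tl Ll.
by have /(congr1 (@^~ w)) :=
  Re_linear_inj LTl ll (fun w => etrans (LRe _) (uT w)).
Qed.

(** Hahn-Banach gives a functional that vanishes on the range and whose real part at [g] is the
    distance from [g] to the range. Weak convergence makes it vanish at [g], so [g] lies in the norm
    closure of the range. *)
Lemma weak_closed_range (F : set_system V) (g : V) : ProperFilter F ->
  closed (range T) -> F (range T) -> F --> (g : weak V) -> range T g.
Proof.
move=> FF cT FT /weak_cvgP Fg; apply: cT.
have f0 : scalar (fun w : realified W => 0 : R).
  by move=> a v w; rewrite mulr0 addr0.
have [] := @hahn_banach_extension R (realified W) (realified V) _ rT _ g
  (rnorm_sublinear V (@ler01 R)) rTl f0.
  by move=> w; rewrite mul1r rnorm_ge0.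
move=> u [ul uN uT ug].
have [L [Ll cL LRe]] := complex_functional (@ler01 R) ul uN.
have LT w : L (T w) = 0.
  have LTl : linear (L \o T) by move=> a v v' /=; rewrite Tl Ll.
  have l0 : linear (fun w : W => 0 : R[i]^o).
    by move=> a v v'; rewrite scaler0 addr0.
  by have /(congr1 (@^~ w)) :=
    Re_linear_inj LTl l0 (fun w => etrans (LRe _) (uT w)).
have Lg : L g = 0.
  apply: (@cvg_unique _ (@norm_hausdorff _ R[i]^o) (L @ F)).
    exact: Fg.
  apply: cvg_near_cst.
  by apply: filterS FT => _ [w _ <-].
have {ug} dist0 : inf [set 1 * rnorm (g - T w) + 0 | w in [set: W]] = 0.
  by rewrite -[LHS]ug -LRe Lg.
move=> B /nbhs_rnormP[e e0 eB]; apply: contrapT => RB.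
suff : e <= 0 by rewrite leNgt e0.
rewrite -dist0; apply: lb_le_inf; first by exists (1 * rnorm (g - T 0) + 0), 0.
move=> _ [w _ <-]; rewrite mul1r addr0 leNgt; apply/negP => gw; apply: RB.
by exists (T w); split; [exists w|exact: eB].
Qed.

(** The image of an ultrafilter has a weak limit in [K], which is some [T w]. The ultrafilter itself
    converges weakly to [w] because every functional on [W] factors through [T]. *)
Lemma weak_compact_preimage (K : set (weak V)) :
  closed (range T) -> compact K -> compact (T @^-1` K : set (weak W)).
Proof.
move=> cT; rewrite !compact_ultra => cK F UF FK.
have UTF : UltraFilter (T @ F) by exact: ultra_fmap.
have [g [Kg Fg]] := cK (T @ F) UTF FK.
have [|w _ Tw] := @weak_closed_range (T @ F) g _ cT _ Fg.
  by apply: (@filterS _ F _ setT) => [w _|]; [exists w|exact: filterT].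
exists w; split; first by rewrite /= Tw.
apply/weak_cvgP => l ll cl; have [L [Ll cL LT]] := functional_extension ll cl.
have -> : l = L \o T by apply/funext => v; rewrite /= LT.
by rewrite /= Tw; exact: (weak_cvgP _ _).1 Fg L Ll cL.
Qed.

End WeakEmbedding.

(** A functional whose real part at [x - y] equals the norm of [x - y] separates the two points. *)
Lemma weak_hausdorff (R : realType) (V : normedModType R[i]) :
  hausdorff_space (weak V).
Proof.
move=> x y; rewrite cluster_cvgE => -[F FF [Fy Fx]].
have [u [ul uN uxy]] :=
  hahn_banach (x - y : realified V) (rnorm_sublinear V (@ler01 R)).
have [l [ll cl lRe]] := complex_functional (@ler01 R) ul uN.
have lxy : l x = l y.
  apply: (@cvg_unique _ (@norm_hausdorff _ R[i]^o) (l @ F)).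
    by apply: (weak_cvgP _ _).1.
  by apply: (weak_cvgP _ _).1.
apply/eqP; rewrite -subr_eq0; apply/eqP/rnorm_eq0.
by rewrite -[LHS]mul1r -uxy -lRe (zmod_morphism_linear ll) lxy subrr.
Qed.

Lemma weak_continuous (R : realType) (W V : normedModType R[i]) (T : W -> V) :
  linear T -> continuous T -> continuous (T : weak W -> weak V).
Proof.
move=> Tl cT x.
have FT : Filter (T @ nbhs (x : weak W)). 
  exact: (@fmap_filter _ _ T _ (@nbhs_filter (weak W) x)).
apply/weak_cvgP => l ll cl.
have : nbhs (x : weak W) --> (x : weak W) by exact: cvg_id.
move=> /weak_cvgP; apply => [a v w|v] /=; first by rewrite Tl ll.
by apply: continuous_comp; [exact: cT|exact: cl].
Qed.

(** * Completeness and total boundedness *)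

(** The Cauchy condition asks for one center per radius, the form in which the completeness
    arguments below produce it. *)
Definition norm_complete (R : realType) (V : normedModType R[i]) :=
  forall F : set_system V, ProperFilter F ->
    (forall e : R, 0 < e ->
      exists v, \forall w \near F, rnorm (v - w) < e) ->
    exists v : V, F --> v.

Lemma isometry_closed_range (R : realType) (W V : normedModType R[i])
    (T : W -> V) :
  linear T -> (forall w, `|T w| = `|w|) -> norm_complete W ->
  closed (range T).
Proof.
move=> Tl T_isom W_complete v; rewrite closureEcvg => -[G GG [Gv rG]].
have TB := zmod_morphism_linear Tl.
have dT w w' : rnorm (T w - T w') = rnorm (w - w') by rewrite -TB /rnorm T_isom.
have GT : G (range T) by exact: rG.
(* This pullback is proper because [G] contains the range, and Cauchy because [T] preserves
   distances. *)
pose F := filter_from G (fun A => T @^-1` A).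
have FF : ProperFilter F.
  apply: filter_from_proper => [|A GA].
    apply: filter_from_filter; first by exists setT; exact: filterT.
    by move=> A B GA GB; exists (A `&` B) => //; exact: filterI.
  have [y [Ay [w _ wy]]] := filter_ex (filterI GA GT).
  by exists w; rewrite /= wy.
have G_near e : 0 < e -> G [set y | rnorm (v - y) < e].
  by move=> e0; apply: Gv; apply/nbhs_rnormP; exists e.
have [e e0|w Fw] := W_complete F FF _.
  have e20 : 0 < e / 2 by rewrite divr_gt0.
  have [y [vy [w _ wy]]] := filter_ex (filterI (G_near _ e20) GT).
  exists w; exists [set y | rnorm (v - y) < e / 2]; first exact: G_near.
  move=> w' /= vw'; rewrite -dT -(subrKA v) (splitr e).
  apply: le_lt_trans (rnormD _ _) _; rewrite ltrD// wy rnorm_distC; exact: vy.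
exists w => //; apply/eqP; rewrite eq_sym -subr_eq0; apply/eqP/rnorm_eq0.
apply/le_anti; rewrite rnorm_ge0 andbT.
apply/ler_addgt0Pr => e e0; rewrite add0r.
have e20 : 0 < e / 2 by rewrite divr_gt0.
have [A GA Aw] : F [set w' | rnorm (w - w') < e / 2].
  by apply: Fw; apply/nbhs_rnormP; exists (e / 2).
have [y [[Aw' vw'] [w' _ w'y]]] :=
  filter_ex (filterI (filterI GA (G_near _ e20)) GT).
rewrite -w'y in Aw' vw'.
rewrite -(subrKA (T w')) (splitr e); apply: le_trans (rnormD _ _) _.
by apply: lerD; apply: ltW => //; rewrite rnorm_distC dT; exact: (Aw w').
Qed.

Section TotallyBounded.
Variables (R : realType) (V : normedModType R[i]) (I : choiceType).
Variable phi : I -> V.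

Definition totally_bounded_family := forall e : R, 0 < e ->
  exists s : seq I, forall i, exists2 j, j \in s & rnorm (phi i - phi j) < e.

Lemma precompact_totally_bounded :
  precompact [set phi i | i in [set: I]] -> totally_bounded_family.
Proof.
rewrite precompactE compact_cover => cphi e e0.
pose B j := [set v | rnorm (phi j - v) < e].
have [|v phiv|s _ sphi] := cphi I setT (fun j => (B j)^°).
- by move=> j _; exact: open_interior.
(* A point [v] of the closure has some [phi j] within [e / 2], so the ball of radius [e / 2] around
   [v] stays inside [B j]. *)
- have : nbhs v [set w | rnorm (v - w) < e / 2].
    by apply/nbhs_rnormP; exists (e / 2) => //; rewrite divr_gt0.
  move=> /phiv[_ [[j _ <-]]] /= vj; exists j => //.
  apply/nbhs_rnormP; exists (e / 2); first by rewrite divr_gt0.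
  move=> w vw; rewrite /B /= -(subrKA v) (splitr e).
  by apply: le_lt_trans (rnormD _ _) _; rewrite ltrD// rnorm_distC.
exists (finmap.enum_fset s) => i.
have [j /= sj] := sphi (phi i) (subset_closure (imageT phi i)).
by move=> /interior_subset Bj; exists j => //; rewrite rnorm_distC.
Qed.

Lemma ultra_cover (F : set_system V) (B : I -> set V) (s : seq I) :
  UltraFilter F -> F [set v | exists2 j, j \in s & B j v] ->
  exists j, F (B j).
Proof.
move=> UF; elim: s => [|i s IHs] Fs.
  by have [v []] := filter_ex Fs.
have [Fi|FiC] := in_ultra_setVsetC (B i) UF; first by exists i.
apply: IHs; apply: filterS2 Fs FiC => v [j].
by rewrite inE => /predU1P[->|js] // Bj _; exists j.
Qed.

(** An ultrafilter on the closure contains one of finitely many balls of each radius, so it is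
    Cauchy and converges. *)
Lemma totally_bounded_precompact : norm_complete V ->
  totally_bounded_family -> precompact [set phi i | i in [set: I]].
Proof.
move=> V_complete tb; rewrite precompactE compact_ultra => F UF Fphi.
have [e e0|v Fv] := V_complete F _.
  have e20 : 0 < e / 2 by rewrite divr_gt0.
  have [s sphi] := tb _ e20.
  have [|j Fj] :=
      @ultra_cover F (fun j => [set v | rnorm (phi j - v) < e]) s UF.
    apply: filterS Fphi => v phiv.
    have : nbhs v [set w | rnorm (v - w) < e / 2].
      by apply/nbhs_rnormP; exists (e / 2).
    move=> /phiv[_ [[i _ <-]]] /= vi; have [j js ij] := sphi i.
    exists j => //; rewrite rnorm_distC -(subrKA (phi i)) (splitr e).
    by apply: le_lt_trans (rnormD _ _) _; rewrite ltrD.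
  by exists (phi j).
exists v; split=> //; apply: (closed_cvg _ _ _ _ Fv) => //.
exact: closed_closure.
Qed.

End TotallyBounded.

(** * The orbit map *)

Section OrbitMap.
Variables (R : realType) (G : topologicalZmodType) (X : dynamical_system R G).
Implicit Types (f h : C X) (x y : X) (t : G).

Lemma bsfun_rnormE (T : Type) (S : bspace R T) (f : bsfun S) :
  rnorm f = supnorm f.
Proof. by rewrite /rnorm bsfun_normE. Qed.

Lemma bsfun_cmod_le (T : Type) (S : bspace R T) (f : bsfun S) z :
  cmod (f z) <= rnorm f.
Proof. by rewrite bsfun_rnormE; apply: supnorm_ub; exact: bsfun_bounded. Qed.

Lemma C_continuous f : continuous f.
Proof. by have /asboolP := bs_valP f. Qed.

Lemma C_complete : norm_complete (C X).
Proof.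
move=> F FF Fc.
have ptwise y : exists l : R[i]^o, (fun f : C X => f y) @ F --> l.
  apply: complex_cauchy_cvg => e e0; have [v Fv] := Fc e e0.
  exists (v y); apply: filterS Fv => w; apply: le_lt_trans.
  exact: (bsfun_cmod_le (v - w)).
pose h y := sval (cid (ptwise y)).
have hP y : (fun f : C X => f y) @ F --> h y by exact: svalP (cid (ptwise y)).
(* Pointwise convergence becomes uniform: [f'] may depend on [y], while the center [v] that links it
   to [f] does not. *)
have unif (e : R) : 0 < e -> F [set f : C X | forall y, cmod (h y - f y) <= e].
  move=> e0; have e30 : 0 < e / 3 by rewrite divr_gt0.
  have [v Fv] := Fc _ e30; apply: (filterS _ Fv) => f /= vf y.
  have [f' [vf' hf']] :
      exists f' : C X, rnorm (v - f') < e / 3 /\ cmod (h y - f' y) < e / 3.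
    have /near_cmodP/(_ _ e30) hy := hP y.
    exact: filter_ex (filterI Fv hy).
  have := le_lt_trans (bsfun_cmod_le (v - f) y) vf.
  have := le_lt_trans (bsfun_cmod_le (v - f') y) vf'.
  rewrite [X in cmod X < _ -> _](_ : _ = v y - f' y)// cmod_distC => vf'y.
  rewrite [X in cmod X < _ -> _](_ : _ = v y - f y)// => vfy.
  rewrite -(subrKA (f' y)); apply: le_trans (cmodD _ _) _.
  rewrite -(subrKA (v y) (f' y)).
  have := cmodD (f' y - v y) (v y - f y); lra.
(* A uniform limit of continuous functions is continuous. *)
have hC : h \in C_space X.
  apply/asboolP => y; apply/near_cmodP => e e0.
  have e30 : 0 < e / 3 by rewrite divr_gt0.
  have [f hf] := filter_ex (unif _ e30).
  have /near_cmodP/(_ _ e30) := @C_continuous f y.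
  apply: filterS => z fyz; rewrite -(subrKA (f y)).
  apply: le_lt_trans (cmodD _ _) _.
  rewrite -(subrKA (f z) (f y)).
  have := cmodD (f y - f z) (f z - h z); have := hf y; have := hf z.
  by rewrite cmod_distC => ? ? ?; lra.
exists (BsFun hC) => B /nbhs_rnormP[e e0 eB].
have e20 : 0 < e / 2 by rewrite divr_gt0.
apply: filterS (unif _ e20) => f hf; apply: eB; rewrite bsfun_rnormE.
apply: (@le_lt_trans _ _ (e / 2)); last by lra.
by apply: supnorm_le => //; exact: ltW.
Qed.

Definition orbit_map x f : Cu R G := f_x f x.

Lemma orbit_map_linear x : linear (orbit_map x).
Proof. by move=> a f h; apply: val_inj. Qed.

Lemma orbit_map_rnorm_le x f : rnorm (orbit_map x f) <= rnorm f.
Proof.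
rewrite [leLHS]bsfun_rnormE; apply: supnorm_le; first exact: rnorm_ge0.
by move=> t; exact: (bsfun_cmod_le f (act t x)).
Qed.

Lemma orbit_map_continuous x : continuous (orbit_map x).
Proof.
move=> f B /nbhs_rnormP[e e0 eB]; apply/nbhs_rnormP; exists e => // h fh.
apply: eB; rewrite -(zmod_morphism_linear (@orbit_map_linear x)).
exact: le_lt_trans (orbit_map_rnorm_le _ _) fh.
Qed.

Lemma orbit_map_f_t x f t :
  orbit_map x (f_t f t) = translate (orbit_map x f) (- t).
Proof.
apply: val_inj; apply/funext => s /=.
by rewrite opprK addrC actD.
Qed.

(** If [cmod (f y)] exceeded [c], it would do so on a neighborhood of [y], which the dense orbit
    meets. *)
Lemma cmod_le_orbit x f (c : R) : transitive_point x ->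
  (forall t, cmod (f (act t x)) <= c) -> forall y, cmod (f y) <= c.
Proof.
move=> x_trans fc y; rewrite leNgt; apply/negP => cfy.
have e0 : 0 < cmod (f y) - c by rewrite subr_gt0.
pose O := [set z | cmod (f y - f z) < cmod (f y) - c]^°.
have Oy : O y by have /near_cmodP/(_ _ e0) := @C_continuous f y.
have [z [Oz [t _ tz]]] := x_trans O (ex_intro _ y Oy) (@open_interior _ _).
have /= := interior_subset Oz; rewrite -tz => fyt.
have := cmodD (f y - f (act t x)) (f (act t x)); rewrite subrK.
by have := fc t => ? ?; lra.
Qed.

Lemma orbit_map_isometry x f : transitive_point x ->
  `|orbit_map x f| = `|f|.
Proof.
move=> x_trans; rewrite !normr_rnorm; congr (_%:C%C).
apply/le_anti; rewrite orbit_map_rnorm_le/= [leLHS]bsfun_rnormE.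
apply: supnorm_le; first exact: rnorm_ge0.
by apply: cmod_le_orbit x_trans _ => t; exact: (bsfun_cmod_le (orbit_map x f)).
Qed.

Lemma weakly_ap_system_point x : weakly_ap_system X -> weakly_ap_point x.
Proof.
move=> X_wap f; have [K AK [K_compact K_closed]] := X_wap f.
have TK_compact : compact (orbit_map x @` K : set (weak (Cu R G))).
  apply: continuous_compact K_compact; apply: continuous_subspaceT.
  exact: weak_continuous (@orbit_map_linear x) (@orbit_map_continuous x).
(* A precompact set needs a compact superset that is also closed; the Hausdorff property makes the
   image of [K] closed. *)
apply: precompact_subset (compact_precompact (@weak_hausdorff _ _) TK_compact).
move=> _ [t _ <-]; exists (f_t f (- t)); last by rewrite orbit_map_f_t opprK.
by apply: AK; exists (- t).
Qed.

Lemma weakly_ap_point_system x :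
  transitive_point x -> weakly_ap_point x -> weakly_ap_system X.
Proof.
move=> x_trans x_wap f; have [K AK [K_compact K_closed]] := x_wap f.
have T_isom h : `|orbit_map x h| = `|h| by exact: orbit_map_isometry.
have T_closed := isometry_closed_range (@orbit_map_linear x) T_isom C_complete.
have := weak_compact_preimage (@orbit_map_linear x) T_isom T_closed K_compact.
move=> /(compact_precompact (@weak_hausdorff _ _)); apply: precompact_subset.
move=> _ [t _ <-]; rewrite /= orbit_map_f_t; apply: AK.
by exists (- t).
Qed.

Lemma bohr_ap_system_point x : bohr_ap_system X -> bohr_ap_point x.
Proof.
move=> X_bap f; split.
- by apply: unif_cont_continuous; have /asboolP[] := bs_valP (f_x f x).
- exact: bsfun_bounded.
move=> e e0; have [s fs] := precompact_totally_bounded (X_bap f) e0.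
exists [set` s]; split; first exact/finite_compact/finite_seq.
move=> t; have [k ks tk] := fs t; exists (t - k), k.
split=> //=; last by rewrite subrK.
apply: le_lt_trans tk; apply: supnorm_le; first exact: rnorm_ge0.
(* At the point [(r - t) x] the difference of [f_t f t] and [f_t f k] is that of [f_x f x] at [r]
   and at [r - (t - k)], so [t - k] is an almost period. *)
move=> r; have := bsfun_cmod_le (f_t f t - f_t f k) (act (r - t) x).
rewrite [X in cmod X <= _](_ : _ =
  f (act t (act (r - t) x)) - f (act k (act (r - t) x)))//.
have -> : act t (act (r - t) x) = act r x by rewrite -actD addrC subrK.
have -> // : act k (act (r - t) x) = act (r - (t - k)) x.
by rewrite -actD opprB addrCA.
Qed.

Lemma bohr_ap_point_system x :
  transitive_point x -> bohr_ap_point x -> bohr_ap_system X.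
Proof.
move=> x_trans x_bap f; apply: totally_bounded_precompact C_complete _ => e e0.
have e30 : 0 < e / 3 by rewrite divr_gt0.
pose g := f_x f x.
have [_ _ /(_ _ e30)[K [K_compact KP]]] := x_bap f.
have /asboolP[[M gM] g_unif] := bs_valP g.
(* Uniform continuity makes [B k] a neighborhood of [k]; finitely many such sets cover the compact
   set [K]. *)
pose B k := [set u | forall r, cmod (g (u + r) - g (k + r)) < e / 3].
have nbhsB k : nbhs k (B k).
  have sub_k : (fun r : G => r - k) @ k --> (0 : G).
    rewrite -(subrr k).
    apply: (@continuous2_cvg _ _ _ _ _ _ id (fun=> k) (fun x y : G => x - y)).
    - exact: (@sub_continuous G (k, k)).
    - exact: cvg_id.
    - exact: cvg_cst.
  have := sub_k _ (g_unif _ e30); rewrite nbhs_simpl /=.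
  by apply: filterS => u /= gu r; have := gu (k + r); rewrite addrA subrK.
(* The covering form of compactness is applied to [G] pointed at [0]. *)
pose pG : ptopologicalType :=
  HB.pack (TopologicalZmodule.sort G) (isPointed.Build G 0).
move: (K_compact : @compact pG K); rewrite compact_cover.
move=> /(_ G K (fun k => (B k)^°)).
case=> [k _|k Kk|s _ Ks]; first exact: open_interior.
  by exists k => //; exact: nbhsB.
exists (finmap.enum_fset s) => t; have [a [k [a_per Kk ->]]] := KP t.
have [j js /interior_subset Bjk] := Ks k Kk; exists j => //.
(* With [t = a + k], one third pays for the almost period [a] and one for replacing [k] by the
   center [j]. The last third keeps the inequality strict after taking the supremum. *)
apply: (@le_lt_trans _ _ (e / 3 + e / 3)); last by lra.
rewrite bsfun_rnormE; apply: supnorm_le; first by rewrite ltW// addr_gt0.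
apply: cmod_le_orbit x_trans _ => r.
rewrite [X in cmod X <= _](_ : _ =
  f (act (a + k) (act r x)) - f (act j (act r x)))//.
rewrite -!actD -/(g (a + k + r)) -/(g (j + r)).
rewrite -(subrKA (g (k + r))); apply: le_trans (cmodD _ _) _.
apply: lerD; last by apply: ltW; exact: Bjk.
apply: le_trans (ltW a_per).
(* This exhibits the difference as that of [g] and its translate by [a], evaluated at
   [a + k + r]. *)
have -> : k + r = a + k + r - a by rewrite addrAC [a + k]addrC addrK.
apply: (@supnorm_ub _ _ (fun s => g s - g (s - a))).
exists (M + M) => u; apply: le_trans (cmodD _ _) _.
by rewrite lerD// -sub0r cmod_distC subr0.
Qed.

End OrbitMap.

Theorem lemma5p4 (R : realType) (G : topologicalZmodType)
    (G_locally_compact : locally_compact [set: G])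
    (G_sigma_compact : sigma_compact G)
    (X : dynamical_system R G) :
  ((weakly_ap_system X -> forall x : X, weakly_ap_point x) /\
   (bohr_ap_system X -> forall x : X, bohr_ap_point x)) /\
  (forall x : X, transitive_point x ->
    (weakly_ap_point x -> weakly_ap_system X) /\
    (bohr_ap_point x -> bohr_ap_system X)).
Proof.
split; first split.
- by move=> X_wap x; exact: weakly_ap_system_point.
- by move=> X_bap x; exact: bohr_ap_system_point.
move=> x x_trans; split.
- exact: weakly_ap_point_system.
- exact: bohr_ap_point_system.
Qed.
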